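(* Let $B$ be a finite connected graph of negative Euler characteristic without half-loops, and let $r$ be a positive integer. Then the set $\mathrm{Tangle}^{\min}_{r,B}$ of $B$-tangles of order less than $r$ that contain no proper subgraph which is a $B$-tangle is finite (up to isomorphism), and every $B$-tangle of order less than $r$ contains at least one element of $\mathrm{Tangle}^{\min}_{r,B}$.
   Context: Graphs are finite, multiple edges and whole-loops allowed, no half-loops; $\mathrm{ord}(\psi)=|E_\psi|-|V_\psi|$. $H_\psi$ is the Hashimoto matrix (indexed by directed edges, $(e,e')$ entry $1$ iff $h(e)=t(e')$ and $e'\ne e^{-1}$), $\rho$ spectral radius. A $B$-tangle is a connected graph $\psi$ admitting an étale morphism to $B$ (a graph morphism injective on the directed edges out of and into each vertex; equivalently $\psi$ occurs as a subgraph of some random cover of $B$) with $\rho(H_\psi)\ge\rho(H_B)^{1/2}$. *)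

(* Defs.v *)
From HB Require Import structures.
From mathcomp Require Import all_boot all_order all_algebra all_field.
Set Implicit Arguments. Unset Strict Implicit. Unset Printing Implicit Defensive.
Import Order.TTheory GRing.Theory Num.Theory.
Local Open Scope ring_scope.

(* A finite graph (multiple edges and whole-loops allowed, no half-loops),
   presented by its finite vertex set, its finite set of directed edges
   (darts), the edge-reversal involution e |-> e^{-1} without fixed points
   (no half-loops), and the head map h.  The tail is t(e) = h(e^{-1}).
   An undirected edge is an orbit {e, e^{-1}}, so |E| = |D|/2. *)
Record graph : Type := Graph {
  gV : finType;
  gD : finType;
  ginv : gD -> gD;
  ghead : gD -> gV;
  ginvK : involutive ginv;
  ginv_nofix : forall e, ginv e != e
}.

Definition gtail (G : graph) (e : gD G) : gV G := ghead (ginv e).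

Definition nedges (G : graph) : nat := #|gD G| %/ 2.
Definition nverts (G : graph) : nat := #|gV G|.

Definition ord (G : graph) : int := (nedges G)%:Z - (nverts G)%:Z.
Definition euler_char (G : graph) : int := (nverts G)%:Z - (nedges G)%:Z.

Definition adj (G : graph) : rel (gV G) :=
  fun u v => [exists e : gD G, (gtail e == u) && (ghead e == v)].
Definition connected (G : graph) : Prop :=
  (0 < #|gV G|)%N /\ forall u v : gV G, connect (@adj G) u v.

Record morphism (G H : graph) := Morph {
  mV : gV G -> gV H;
  mD : gD G -> gD H;
  mD_inv : forall e, mD (ginv e) = ginv (mD e);
  mD_head : forall e, ghead (mD e) = mV (ghead e)
}.

Definition etale (G H : graph) (f : morphism G H) : Prop :=
  forall v : gV G,
    {in [pred e | gtail e == v] &, injective (mD f)} /\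
    {in [pred e | ghead e == v] &, injective (mD f)}.

Definition embedding (G H : graph) (f : morphism G H) : Prop :=
  injective (mV f) /\ injective (mD f).

Definition isomorphism (G H : graph) (f : morphism G H) : Prop :=
  bijective (mV f) /\ bijective (mD f).
Definition isomorphic (G H : graph) : Prop := exists f : morphism G H, isomorphism f.

Definition hashimoto (G : graph) : 'M[algC]_#|gD G| :=
  \matrix_(i, j)
    (if (ghead (enum_val i) == gtail (enum_val j)) && (enum_val j != ginv (enum_val i))
     then 1 else 0).

(* spectral radius: the maximum modulus of the (complex) eigenvalues,
   i.e. of the roots of the characteristic polynomial (0 for a 0x0 matrix) *)
Definition eigenvalues (n : nat) (A : 'M[algC]_n) : seq algC :=
  sval (closed_field_poly_normal (char_poly A)).
Definition spectral_radius (n : nat) (A : 'M[algC]_n) : algC :=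
  \big[Num.max/0]_(z <- eigenvalues A) `|z|.

Definition rho (G : graph) : algC := spectral_radius (hashimoto G).

Definition is_tangle (B psi : graph) : Prop :=
  connected psi /\ (exists f : morphism psi B, etale f) /\
  sqrtC (rho B) <= rho psi.

Definition has_proper_subtangle (B psi : graph) : Prop :=
  exists (phi : graph) (f : morphism phi psi),
    is_tangle B phi /\ embedding f /\ ~ isomorphism f.

Definition min_tangle (B : graph) (r : nat) (psi : graph) : Prop :=
  is_tangle B psi /\ ord psi < r%:Z /\ ~ has_proper_subtangle B psi.

(* Main.v *)
(** A matrix with nonnegative entries has spectral radius less than [c] exactly when it admits a
    positive vector [y] with [A y < c y] (a supersolution). Let [nu] be the square root of [rho B]; a
    left subsolution built from the distance to the last branching vertex shows [nu > 1].

    A minimal tangle has no vertex of degree at most 1, hence consists of boundedly many paths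
    ("beads") joining vertices of degree at least 3, their number being controlled by the order.
    If some beads were much longer than all the others, the proper subgraph formed by the short beads
    would by minimality have radius less than [nu], hence a supersolution, which extends to the long
    beads by an exponentially growing weight: then the whole graph has radius less than [nu], a
    contradiction. So the bead lengths are bounded successively, from the shortest to the longest.

    Existence of a minimal subtangle is an induction on the size, as the order does not increase when
    passing to a connected subgraph of a connected graph. *)
Require Import Defs.
From HB Require Import structures.
From Stdlib Require Import Classical.
From mathcomp Require Import all_boot all_order all_algebra all_field.
From mathcomp Require Import polyrcf lra zify.
Set Implicit Arguments. Unset Strict Implicit. Unset Printing Implicit Defensive.
Import Order.TTheory GRing.Theory Num.Theory.
Local Open Scope ring_scope.

(** * Supersolutions of nonnegative matrices *)

Lemma seq_max (R : realDomainType) (s : seq R) :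
  s != [::] -> exists2 m, m \in s & {in s, forall x, x <= m}.
Proof.
elim: s => // a s IHs _; have [->|/IHs[m ms mP]] := eqVneq s [::].
  by exists a; rewrite ?mem_head // => x; rewrite inE => /eqP->.
have [am|ma] := leP a m.
  exists m; first by rewrite inE ms orbT.
  by move=> x; rewrite inE => /predU1P[->|/mP].
exists a; rewrite ?mem_head // => x; rewrite inE => /predU1P[->//|/mP xm].
exact: le_trans xm (ltW ma).
Qed.

Lemma horner_gt0_no_root (R : rcfType) (p : {poly R}) (a b : R) :
  a <= b -> 0 < p.[b] -> (forall t, a <= t -> ~~ root p t) -> 0 < p.[a].
Proof.
move=> ab pb nr; rewrite ltNge; apply/negP => pa.
have [|t /andP[tab _] rt] := poly_ivt (p := p) ab; first by rewrite pa ltW.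
by have := nr t tab; rewrite rt.
Qed.

(** The witness [q] is the vector of row sums of the adjugate of [t - A], for which [t q = p + A q];
    thus [A q < c q] at [c], as [p.[c] > 0]. Positivity of [q] is carried down from large [t]: at
    the largest root [m >= c] of some [q i], all [q j] would still be nonnegative, so [p.[m] > 0]
    would contradict [(q i).[m] = 0]. *)
Lemma nonneg_mx_supersolution (R : rcfType) n (A : 'M[R]_n) (c : R) :
  (forall i j, 0 <= A i j) -> (forall t, c <= t -> ~~ root (char_poly A) t) ->
  exists y : 'I_n -> R,
    forall i, 0 < y i /\ \sum_j A i j * y j < c * y i.
Proof.
move=> A0 nr; pose p := char_poly A.
pose q i := \sum_j (\adj (char_poly_mx A)) i j.
have qE t i : t * (q i).[t] = p.[t] + \sum_j A i j * (q j).[t].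
  have : \sum_k (char_poly_mx A *m \adj (char_poly_mx A)) i k = p.
    rewrite mul_mx_adj (bigD1 i) //= big1 ?addr0 => [|k /negPf ki].
      by rewrite mxE eqxx mulr1n.
    by rewrite mxE eq_sym ki.
  move/(congr1 (horner^~ t)) => <-.
  under eq_bigr do rewrite mxE.
  rewrite exchange_big /=.
  under eq_bigr => j _.
    rewrite -mulr_sumr -/(q j).
    have -> : char_poly_mx A i j = 'X *+ (i == j) - (A i j)%:P by rewrite !mxE.
    rewrite mulrBl mulrnAl; over.
  rewrite sumrB hornerD hornerN 2![in RHS]horner_sum.
  under [X in _ - X]eq_bigr do rewrite hornerM hornerC.
  rewrite subrK [RHS](bigD1 i) //= big1 => [|j /negPf ij].
    by rewrite eqxx mulr1n hornerM hornerX addr0.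
  by rewrite eq_sym ij mulr0n horner0.
have qpos t : 0 < p.[t] -> (forall i, 0 <= (q i).[t]) -> forall i, 0 < (q i).[t].
  move=> pt qt i; rewrite lt_def qt andbT; apply/eqP => qi.
  have := qE t i; rewrite qi mulr0 => /esym/eqP; apply/negP.
  by rewrite gt_eqF // ltr_wpDr // sumr_ge0 // => j _; rewrite mulr_ge0.
have [M Mp] : exists M, forall t, M <= t -> 0 < p.[t] /\ forall i, 0 < (q i).[t].
  have lp : lead_coef p = 1 by apply/eqP/char_poly_monic.
  have [|M0 M0P] := @poly_pinfty_gt_lc _ p; first by rewrite lp.
  have S0 : 0 <= \sum_i \sum_j A i j by rewrite sumr_ge0 // => i _; rewrite sumr_ge0.
  exists (`|M0| + \sum_i \sum_j A i j + 1) => t Mt.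
  have pt : 0 < p.[t].
    have := M0P t; rewrite lp => /(_ _) H; apply: lt_le_trans (H _) => //.
    by have := ler_norm M0; move: Mt S0; lra.
  split=> // i0.
  (* At an index [i] minimising [(q i).[t]], [qE] gives [(t - \sum_j A i j) (q i).[t] >= p.[t] >
     0]. *)
  pose s := [seq - (q i).[t] | i <- enum 'I_n].
  have sP i : - (q i).[t] \in s by apply/map_f; rewrite mem_enum.
  have [|m /mapP[i _ ->] mP] := @seq_max _ s; first by apply: contraTneq (sP i0) => ->.
  have {}mP j : (q i).[t] <= (q j).[t] by rewrite -lerN2 mP.
  apply: lt_le_trans (mP i0).
  have ti : 0 < t - \sum_j A i j.
    have : \sum_j A i j <= \sum_i \sum_j A i j.
      by rewrite [leRHS](bigD1 i) //= lerDl sumr_ge0 // => k _; rewrite sumr_ge0.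
    by have := normr_ge0 M0; move: Mt; lra.
  rewrite -(pmulr_rgt0 _ ti) mulrBl qE -addrA ltr_wpDr // subr_ge0 mulr_suml.
  by apply: ler_sum => j _; rewrite ler_wpM2l.
pose F := \prod_i q i.
have rF t : root F t = [exists i, root (q i) t].
  rewrite /root horner_prod prodf_seq_eq0; apply/hasP/existsP.
    by case=> i _ /= ri; exists i.
  by case=> i ri; exists i => //; rewrite mem_index_enum.
have F0 : F != 0.
  apply: contra_neq (_ : F.[M] != 0) => [->|]; first by rewrite horner0.
  by rewrite horner_prod prodf_seq_neq0; apply/allP => i _; rewrite gt_eqF //; case: (Mp M (lexx _)).
have pgt0 t : c <= t -> 0 < p.[t].
  move=> ct; apply: (@horner_gt0_no_root _ _ _ (Num.max t M)); first by rewrite le_max lexx.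
    by case: (Mp (Num.max t M)) => //; rewrite le_max lexx orbT.
  by move=> u tu; apply/nr/(le_trans ct).
have noroot t : c <= t -> ~~ root F t.
  move=> ct; apply/negP => rt.
  have tM : t < M.
    rewrite ltNge; apply/negP => /Mp[_ qt]; move: rt; rewrite rF => /existsP[i].
    by rewrite /root gt_eqF.
  (* [roots] works on an open interval; starting it at [c - 1] keeps [c] itself. *)
  have tin : t \in roots F (c - 1) M.
    by rewrite in_roots rt F0 in_itv /= tM andbT; lra.
  have [|m] := @seq_max _ (roots F (c - 1) M); first by apply: contraL tin => /eqP->.
  rewrite in_roots => /and3P[rm _ _] mP.
  have cm : c <= m := le_trans ct (mP _ tin).
  have nrm u : m < u -> ~~ root F u.
    move=> mu; apply/negP => ru.
    have uM : u < M.
      rewrite ltNge; apply/negP => /Mp[_ qt]; move: ru; rewrite rF => /existsP[i].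
      by rewrite /root gt_eqF.
    have /mP : u \in roots F (c - 1) M by rewrite in_roots ru F0 in_itv /= uM; lra.
    by rewrite leNgt mu.
  have qm i : 0 <= (q i).[m].
    rewrite leNgt; apply/negP => qim.
    have mb : m <= Num.max (m + 1) M by rewrite le_max; apply/orP; left; lra.
    have [|u /andP[mu _] ru] := @poly_ivt _ (q i) _ _ mb.
      by rewrite ltW //= ltW //; case: (Mp (Num.max (m + 1) M)) => //; rewrite le_max lexx orbT.
    have : m < u by rewrite lt_def mu andbT; apply: contraTneq ru => ->; rewrite /root lt_eqF.
    by move/nrm; rewrite rF => /existsP; case; exists i.
  move: rm; rewrite rF => /existsP[i]; rewrite /root gt_eqF //.
  by apply: qpos => //; apply: pgt0.
exists (fun i => (q i).[c]) => i; split.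
  apply: (@horner_gt0_no_root _ _ _ (Num.max c M)); first by rewrite le_max lexx.
    by case: (Mp (Num.max c M)) => //; rewrite le_max lexx orbT.
  by move=> u /noroot; rewrite rF; apply: contra => ri; apply/existsP; exists i.
by rewrite qE ltrDr pgt0.
Qed.

(** Pairing [x] with the moduli of a left eigenvector [v] gives [|z| \sum |v_i| x_i <= \sum |v_i| (A
    x)_i < c \sum |v_i| x_i]. *)
Lemma supersolution_eigenvalue_lt n (A : 'M[algC]_n) (c z : algC) (x : 'I_n -> algC) :
  (forall i j, 0 <= A i j) -> (forall i, 0 < x i /\ \sum_j A i j * x j < c * x i) ->
  root (char_poly A) z -> `|z| < c.
Proof.
move=> A0 xP; rewrite -eigenvalue_root_char => /eigenvalueP[v vA v0].
have [i0 vi0] : exists i, v 0 i != 0 by apply/rV0Pn.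
have s0 : 0 < \sum_i `|v 0 i| * x i.
  rewrite (bigD1 i0) //= ltr_wpDr ?sumr_ge0 // => [i _|].
    by rewrite mulr_ge0 // ltW //; case: (xP i).
  by rewrite mulr_gt0 ?normr_gt0 //; case: (xP i0).
rewrite -(ltr_pM2r s0).
apply: (@le_lt_trans _ _ (\sum_i `|v 0 i| * \sum_j A i j * x j)).
  rewrite mulr_sumr.
  under [leRHS]eq_bigr do rewrite mulr_sumr.
  rewrite exchange_big /=; apply: ler_sum => i _.
  have := congr1 (fun w : 'rV_n => w 0 i) vA; rewrite !mxE => vi.
  rewrite mulrA -normrM -vi.
  under [leRHS]eq_bigr do rewrite mulrA.
  rewrite -mulr_suml ler_wpM2r //; first by rewrite ltW //; case: (xP i).
  apply: le_trans (ler_norm_sum _ _ _) _.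
  by apply: ler_sum => j _; rewrite normrM (ger0_norm (A0 _ _)).
rewrite mulr_sumr (bigD1 i0) //= [ltRHS](bigD1 i0) //= ltr_leD //.
  by rewrite mulrCA ltr_pM2l ?normr_gt0 //; case: (xP i0).
apply: ler_sum => i _; rewrite mulrCA ler_wpM2l // ltW //; by case: (xP i).
Qed.

(** A strict positive supersolution for the 0-1 matrix of [e] restricted to [S]. Stated for
    relations, it passes to sets of darts without reindexing a matrix. *)
Definition subcritical (T : finType) (e : rel T) (S : {set T}) (c : algR) : Prop :=
  exists y : T -> algR, forall x, x \in S ->
    0 < y x /\ \sum_(x' in S | e x x') y x' < c * y x.

Definition nonbacktracking (G : graph) : rel (gD G) :=
  fun e e' => (ghead e == gtail e') && (e' != ginv e).

Lemma eigenvaluesP n (A : 'M[algC]_n) z : (z \in eigenvalues A) = root (char_poly A) z.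
Proof.
rewrite /eigenvalues; case: closed_field_poly_normal => s /= sP.
by rewrite sP (monicP (char_poly_monic A)) scale1r root_prod_XsubC.
Qed.

Lemma spectral_radius_ge0 n (A : 'M[algC]_n) : 0 <= spectral_radius A.
Proof.
rewrite /spectral_radius; elim: eigenvalues => [|z s IH]; first by rewrite big_nil.
by rewrite big_cons /Num.max; case: ifP.
Qed.

Lemma spectral_radius_lt n (A : 'M[algC]_n) (c : algC) : 0 < c ->
  (forall z, root (char_poly A) z -> `|z| < c) <-> spectral_radius A < c.
Proof.
move=> c0; rewrite /spectral_radius.
have -> : (forall z, root (char_poly A) z -> `|z| < c) <->
          {in eigenvalues A, forall z, `|z| < c}.
  by split=> H z; [rewrite eigenvaluesP|rewrite -eigenvaluesP]; apply: H.
elim: (eigenvalues A) => [|z s IH]; first by rewrite big_nil.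
rewrite big_cons.
(* [algC] is only partially ordered: bounding a maximum requires comparable arguments, here real
   ones. *)
have real : `|z| >=< \big[Num.max/0]_(w <- s) `|w|.
  apply: real_comparable; rewrite ?normr_real //.
  elim: {IH}s => [|w s IHs]; rewrite ?big_nil ?real0 // big_cons /Num.max.
  by case: ifP => //; rewrite normr_real.
rewrite comparable_gt_max //; split => [H|/andP[zc /IH H] w].
  rewrite H ?mem_head //=; apply/IH => w ws; apply: H.
  by rewrite inE ws orbT.
by rewrite inE => /predU1P[->|/H].
Qed.

Lemma algRval_lt (x y : algR) : (algRval x < algRval y) = (x < y).
Proof. by []. Qed.

(** The supersolution is found over the real closed field [algR], where intermediate values exist;
    conversely the eigenvalues are bounded over [algC], for the same 0-1 matrix. *)
Lemma rho_lt_subcritical (G : graph) (c : algR) : 0 < c ->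
  rho G < algRval c <-> subcritical (@nonbacktracking G) [set: gD G] c.
Proof.
move=> c0; have c0' : 0 < algRval c by [].
pose H : 'M[algR]_#|gD G| := \matrix_(i, j) (nonbacktracking (enum_val i) (enum_val j))%:R.
have HE : hashimoto G = map_mx algRval H.
  by apply/matrixP => i j; rewrite !mxE /nonbacktracking; case: ifP.
have sumE (F : gD G -> algR) i :
    \sum_j H i j * F (enum_val j) = \sum_(e in [set: gD G] | nonbacktracking (enum_val i) e) F e.
  rewrite (eq_bigl (fun e => (e \in gD G) && nonbacktracking (enum_val i) e)); last first.
    by move=> e; rewrite !inE.
  rewrite big_mkcondr /= [RHS]big_enum_val /=; apply: eq_bigr => j _.
  by rewrite mxE; case: nonbacktracking; rewrite ?mul1r ?mul0r.
rewrite /rho -(spectral_radius_lt _ c0'); split => [root_lt|[y yP] z].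
  have [|t ct|y yP] := @nonneg_mx_supersolution _ _ H c.
  - by move=> i j; rewrite mxE ler0n.
  - apply/negP => rt; have := root_lt (algRval t).
    rewrite HE -map_char_poly fmorph_root => /(_ rt).
    rewrite ger0_norm; last by apply: ltW; apply: lt_le_trans c0 ct.
    by rewrite algRval_lt ltNge ct.
  exists (fun e => y (enum_rank e)) => e _; have [y0] := yP (enum_rank e).
  split=> //; rewrite -[X in nonbacktracking X](enum_rankK e) -sumE.
  by under eq_bigr do rewrite enum_valK.
apply: (@supersolution_eigenvalue_lt _ _ _ _ (fun i => algRval (y (enum_val i)))).
  by move=> i j; rewrite HE !mxE /=; case: nonbacktracking.
move=> i; have [y0 ylt] := yP (enum_val i) (in_setT _); split=> //.
rewrite HE -rmorphM /= (_ : \sum_j _ = algRval (\sum_j H i j * y (enum_val j))).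
  by move: ylt; rewrite -sumE -algRval_lt.
by rewrite rmorph_sum; apply: eq_bigr => j _; rewrite mxE rmorphM.
Qed.

Lemma rho_ge0 G : 0 <= rho G.
Proof. exact: spectral_radius_ge0. Qed.

(** * Extending supersolutions *)

Lemma ler_sum_card (R : numDomainType) (T : finType) (P : pred T) (F : T -> R) (b : R) n :
  0 <= b -> (#|[set x | P x]| <= n)%N -> (forall x, P x -> F x <= b) ->
  \sum_(x | P x) F x <= b *+ n.
Proof.
move=> b0 cn Fb; apply: le_trans (_ : b *+ #|[set x | P x]| <= _).
  rewrite -sumr_const [leRHS](eq_bigl P) => [|x]; last by rewrite inE.
  exact: ler_sum.
by rewrite -[leLHS]mulr_natr -[leRHS]mulr_natr ler_wpM2l // ler_nat.
Qed.

Lemma expr_unbounded (R : archiRealFieldType) (mu b : R) : 1 < mu ->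
  exists L, forall n, (L <= n)%N -> b < mu ^+ n.
Proof.
move=> mu1; have d0 : 0 < mu - 1 by rewrite subr_gt0.
have bern n : n%:R * (mu - 1) < mu ^+ n.
  elim: n => [|n IH]; first by rewrite mul0r ltr01.
  have p1 : 1 <= mu ^+ n by rewrite exprn_ege1 // ltW.
  rewrite exprS -natr1; have : 0 <= (mu - 1) * (mu ^+ n - 1).
    by rewrite mulr_ge0 // ?subr_ge0 // ltW.
  by move: IH; lra.
exists (Num.bound `|b / (mu - 1)|) => n Ln; apply: le_lt_trans (bern n).
rewrite -ler_pdivrMr //; apply: le_trans (ler_norm _) _.
apply: ltW; apply: lt_le_trans (archi_boundP (normr_ge0 _)) _.
by rewrite ler_nat.
Qed.

(** A normalised supersolution: the slack of 1 leaves room for darts leaving [S], and [Y] bounds the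
    weights met on entering [S]. *)
Definition tight_supersolution (T : finType) (e : rel T) (S : {set T}) (c Y : algR) : Prop :=
  exists y : T -> algR, forall x, x \in S ->
    1 <= y x <= Y /\ \sum_(x' in S | e x x') y x' <= c * y x - 1.

Lemma tight_supersolution_le (T : finType) (e : rel T) (S : {set T}) c Y Y' :
  Y <= Y' -> tight_supersolution e S c Y -> tight_supersolution e S c Y'.
Proof.
move=> YY [y yP]; exists y => x /yP[/andP[y1 yY] ys].
by rewrite y1 (le_trans yY YY).
Qed.

Lemma subcritical_tight (T : finType) (e : rel T) (S : {set T}) c :
  subcritical e S c -> exists Y, tight_supersolution e S c Y.
Proof.
case=> y yP; pose d x := c * y x - \sum_(x' in S | e x x') y x'.
have y0 x : x \in S -> 0 < y x by case/yP.
have d0 x : x \in S -> 0 < d x by case/yP=> _; rewrite subr_gt0.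
have sum_ge F x : x \in S -> (forall x, x \in S -> 0 < F x) ->
    F x <= \sum_(x' in S) F x' :> algR.
  move=> xS F0; rewrite (bigD1 x) //= lerDl sumr_ge0 // => x' /andP[/F0/ltW] //.
(* [Z] is at least [1 / y x] and [1 / d x] for every [x] in [S], so scaling by it lifts weights and
   slacks to at least 1. *)
pose Z := \sum_(x in S) (y x)^-1 + \sum_(x in S) (d x)^-1.
exists (\sum_(x in S) Z * y x), (fun x => Z * y x) => x xS.
have iy := sum_ge (fun x => (y x)^-1) x xS; have id := sum_ge (fun x => (d x)^-1) x xS.
have {}iy : (y x)^-1 <= \sum_(x in S) (y x)^-1.
  by apply: iy => z zS; rewrite invr_gt0 y0.
have {}id : (d x)^-1 <= \sum_(x in S) (d x)^-1.
  by apply: id => z zS; rewrite invr_gt0 d0.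
have iy0 : 0 < (y x)^-1 by rewrite invr_gt0 y0.
have id0 : 0 < (d x)^-1 by rewrite invr_gt0 d0.
have Z0 : 0 < Z by rewrite /Z; lra.
split; first (apply/andP; split).
- by rewrite -ler_pdivrMr ?y0 // mul1r /Z; lra.
- by apply: (sum_ge (fun x => Z * y x)) => // z zS; rewrite mulr_gt0 ?y0.
rewrite -mulr_sumr mulrCA lerBrDr -lerBrDl -mulrBr -/(d x).
by rewrite -ler_pdivrMr ?d0 // mul1r /Z; lra.
Qed.

(* There are only finitely many relations on at most N points. *)
Lemma tight_supersolution_uniform (c : algR) (N : nat) :
  exists Y, forall (T : finType) (e : rel T) (S : {set T}),
    (#|S| <= N)%N -> subcritical e S c -> tight_supersolution e S c Y.
Proof.
have fixn n : exists Y, 0 <= Y /\ forall M : {ffun 'I_n * 'I_n -> bool},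
    let e := (fun i j => M (i, j)) in
    subcritical e setT c -> tight_supersolution e setT c Y.
  have H (M : {ffun 'I_n * 'I_n -> bool}) : exists Y, 0 <= Y /\
      (subcritical (fun i j => M (i, j)) setT c ->
       tight_supersolution (fun i j => M (i, j)) setT c Y).
    have [/subcritical_tight[Y YP]|no] := classic (subcritical (fun i j => M (i, j)) setT c).
      exists `|Y|; split=> // _; exact: tight_supersolution_le (ler_norm _) YP.
    by exists 0.
  have [Y YP] := fin_all_exists H.
  exists (\sum_M Y M); split; first by rewrite sumr_ge0 // => M _; case: (YP M).
  move=> M e /(proj2 (YP M)); apply: tight_supersolution_le.
  by rewrite (bigD1 M) //= lerDl sumr_ge0 // => M' _; case: (YP M').
have [Y YP] := fin_all_exists (fun n : 'I_N.+1 => fixn n).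
exists (\sum_n Y n) => T e S SN [y yP].
pose M : {ffun 'I_#|S| * 'I_#|S| -> bool} := [ffun ij => e (enum_val ij.1) (enum_val ij.2)].
have sumE (F : T -> algR) x : \sum_(x' in S | e x x') F x' =
    \sum_(j in [set: 'I_#|S|] | e x (enum_val j)) F (enum_val j).
  rewrite big_mkcondr big_enum_val -big_mkcond /=.
  by apply: eq_bigl => j; rewrite inE.
have [_ /(_ M)] := YP (Ordinal (SN : #|S| < N.+1)%N); case.
  exists (fun i => y (enum_val i)) => i _; have [y0 H] := yP _ (enum_valP i).
  split=> //; move: H; rewrite sumE; congr (_ < _).
  by apply: eq_bigl => j; rewrite ffunE.
move=> w wP.
have wE i : \sum_(j | enum_val j == enum_val i :> T) w j = w i.
  by apply: big_pred1 => j; rewrite (inj_eq enum_val_inj).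
(* Transport of [w] back to [T]: the sum has exactly one term on [S] and is empty elsewhere. *)
exists (fun x => \sum_(i | enum_val i == x) w i) => x xS.
rewrite -(enum_rankK_in xS xS); set i := enum_rank_in _ _.
have [/andP[w1 wY] ws] := wP i (in_setT _); rewrite wE sumE w1; split.
  apply: le_trans wY _; rewrite (bigD1 (Ordinal (SN : #|S| < N.+1)%N)) //= lerDl.
  by rewrite sumr_ge0 // => n _; case: (YP n).
apply: le_trans ws; rewrite le_eqVlt; apply/orP; left; apply/eqP.
by apply: eq_big => [j|j _]; rewrite ?ffunE ?wE.
Qed.

(* Off S the supersolution is eps * mu ^ k with 1 < mu < c: this grows along a path leaving S, so at
   the far end of a long enough path it dominates the bounded weights found on S. *)
Lemma subcritical_extension (c : algR) (Delta N : nat) : 1 < c ->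
  exists L, forall (T : finType) (e : rel T) (S : {set T}) (k : T -> nat),
    (forall x, #|[set x' | e x x']| <= Delta)%N -> (#|S| <= N)%N ->
    subcritical e S c ->
    (forall x x', x \in S -> e x x' -> x' \notin S -> k x' = 0) ->
    (forall x, x \notin S ->
      ((#|[set x' | e x x']| <= 1)%N /\
         forall x', e x x' -> x' \notin S /\ (k x' <= (k x).+1)%N) \/
      ((L <= k x)%N /\ forall x', e x x' -> x' \in S \/ k x' = 0)) ->
    subcritical e setT c.
Proof.
move=> c1; have [Y YP] := tight_supersolution_uniform c N.
(* Any [mu] strictly between 1 and [c] would do. With this [eps], at most [Delta] successors outside
   [S], all of exponent 0, weigh less than the slack of 1. *)
pose mu : algR := (1 + c) / 2%:R; pose eps : algR := Delta.+1%:R^-1.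
have mu1 : 1 < mu by rewrite /mu; lra.
have muc : mu < c by rewrite /mu; lra.
have e0 : 0 < eps by rewrite invr_gt0 ltr0n.
have e1 : eps <= 1 by rewrite invf_le1 ?ltr0n // ler1n.
have De : eps *+ Delta < 1.
  by rewrite -mulr_natl ltr_pdivrMr ?ltr0n // mul1r ltr_nat.
have [L LP] := expr_unbounded ((`|Y| + 1) *+ Delta / (c * eps)) mu1.
exists L => T e S k degD SN /(YP _ _ _ SN)[y yP] kS kT.
have mu0 n : 0 < mu ^+ n by rewrite exprn_gt0 //; lra.
exists (fun x => if x \in S then y x else eps * mu ^+ k x) => x _.
have pos z : 0 < if z \in S then y z else eps * mu ^+ k z.
  by case: ifP => [/yP[/andP[? _] _]|_]; [lra|rewrite mulr_gt0].
split=> //; rewrite (eq_bigl (e x)) => [|z]; last by rewrite inE.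
have [xS|xS] := boolP (x \in S).
  have [_ ys] := yP _ xS; rewrite (bigID (mem S)) /=.
  rewrite (_ : \sum_(i | e x i && (i \in S)) _ = \sum_(z in S | e x z) y z); last first.
    by apply: eq_big => [z|z /andP[_ ->]] //; rewrite andbC.
  have : \sum_(z | e x z && (z \notin S)) (if z \in S then y z else eps * mu ^+ k z) <= eps *+ Delta.
    apply: ler_sum_card; first exact: ltW.
      by apply: leq_trans (degD x); apply/subset_leq_card/subsetP => z; rewrite !inE => /andP[].
    by move=> z /andP[exz zS]; rewrite (negPf zS) (kS x z) // expr0 mulr1.
  by lra.
have [[deg1 kx]|[Lk kx]] := kT _ xS.
  apply: le_lt_trans (_ : eps * mu ^+ (k x).+1 < _).
    rewrite -[leRHS]mulr1n; apply: ler_sum_card => //; first by rewrite mulr_ge0 // ltW.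
    move=> z exz; have [/negPf-> kz] := kx _ exz.
    by rewrite ler_pM2l // ler_eXn2l.
  by rewrite exprS mulrCA ltr_pM2r // mulr_gt0.
apply: le_lt_trans (_ : (`|Y| + 1) *+ Delta < _).
  apply: ler_sum_card => // [|z exz]; first by have := normr_ge0 Y; lra.
  have := ler_norm Y; have := normr_ge0 Y.
  case: ifP => [/yP[/andP[_ zY] _]|zS]; first by lra.
  by have [|->] := kx _ exz; rewrite ?zS // expr0 mulr1; lra.
have ce0 : 0 < c * eps by rewrite mulr_gt0 //; lra.
by rewrite mulrA mulrC -ltr_pdivrMr // LP.
Qed.

(** * Subgraphs *)

Lemma gtailV (G : graph) (e : gD G) : gtail (ginv e) = ghead e.
Proof. by rewrite /gtail ginvK. Qed.

Lemma ginv_inj (G : graph) : injective (@ginv G).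
Proof. exact: inv_inj (@ginvK G). Qed.

Lemma nonbacktrackingV (G : graph) (e e' : gD G) :
  nonbacktracking (ginv e') (ginv e) = nonbacktracking e e'.
Proof.
rewrite /nonbacktracking gtailV ginvK eq_sym; congr (_ && _).
by rewrite [e' == _]eq_sym.
Qed.

Lemma adj_sym (G : graph) : symmetric (@adj G).
Proof.
have imp (u v : gV G) : adj u v -> adj v u.
  case/existsP=> e /andP[/eqP<- /eqP<-]; apply/existsP; exists (ginv e).
  by rewrite gtailV !eqxx.
by move=> u v; apply/idP/idP; apply: imp.
Qed.

Definition comp_morphism (G H K : graph) (g : morphism H K) (f : morphism G H) : morphism G K.
Proof.
exists (mV g \o mV f) (mD g \o mD f) => e /=; first by rewrite !mD_inv.
by rewrite !mD_head.
Defined.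

Lemma comp_embedding (G H K : graph) (g : morphism H K) (f : morphism G H) :
  embedding g -> embedding f -> embedding (comp_morphism g f).
Proof. by move=> [gV gD] [fV fD]; split; apply: inj_comp. Qed.

Lemma mD_tail (G H : graph) (f : morphism G H) e : gtail (mD f e) = mV f (gtail e).
Proof. by rewrite /gtail -mD_inv mD_head. Qed.

Lemma comp_etale_embedding (G H K : graph) (g : morphism H K) (f : morphism G H) :
  etale g -> embedding f -> etale (comp_morphism g f).
Proof.
move=> get [fV fD] v; have [gt gh] := get (mV f v).
split=> e e'; rewrite !inE => /eqP ev /eqP ev' /= .
  by move/gt => E; apply/fD/E; rewrite inE mD_tail ?ev ?ev'.
by move/gh => E; apply/fD/E; rewrite inE mD_head ?ev ?ev'.
Qed.

Definition subgraph (G : graph) (U : {set gV G}) (S : {set gD G})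
  (SV : forall e, e \in S -> ginv e \in S) (SU : forall e, e \in S -> ghead e \in U) : graph.
Proof.
apply: (@Graph {v | v \in U} {e | e \in S}
  (fun e => exist _ (ginv (val e)) (SV _ (valP e)))
  (fun e => exist _ (ghead (val e)) (SU _ (valP e)))).
- by move=> e; apply: val_inj; rewrite /= ginvK.
- by move=> e; rewrite -val_eqE /= ginv_nofix.
Defined.

Definition subgraph_incl (G : graph) (U : {set gV G}) (S : {set gD G}) SV SU :
  morphism (@subgraph G U S SV SU) G.
Proof. by exists val val. Defined.

Lemma subgraph_incl_embedding (G : graph) (U : {set gV G}) (S : {set gD G}) SV SU :
  embedding (@subgraph_incl G U S SV SU).
Proof. by split; apply: val_inj. Qed.

Lemma subcritical_subgraph (G : graph) (U : {set gV G}) (S : {set gD G}) SV SU c :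
  subcritical (@nonbacktracking (@subgraph G U S SV SU)) setT c <->
  subcritical (@nonbacktracking G) S c.
Proof.
have nbE (e e' : gD (@subgraph G U S SV SU)) :
  nonbacktracking e e' = nonbacktracking (val e) (val e').
  by rewrite /nonbacktracking /= -!val_eqE.
have sumE (F : gD G -> algR) (e : gD (@subgraph G U S SV SU)) :
    \sum_(e' in S | nonbacktracking (val e) e') F e' =
    \sum_(e' in [set: gD (@subgraph G U S SV SU)] | nonbacktracking e e') F (val e').
  rewrite big_sub_cond; apply: eq_bigl => e'.
  by rewrite inE nbE.
split=> -[y yP].
  exists (fun e => if insub e is Some e' then y e' else 0) => e eS.
  have [y0 ys] := yP (exist _ e eS) (in_setT _).
  rewrite insubT /=; split=> //.
  rewrite -[e]/(val (exist (fun e => e \in S) e eS)) sumE.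
  by under eq_bigr do rewrite valK.
exists (fun e => y (val e)) => e _; have [y0] := yP _ (valP e).
by rewrite sumE.
Qed.

Lemma rho_ltNge (G H : graph) : (rho G < sqrtC (rho H)) = ~~ (sqrtC (rho H) <= rho G).
Proof. by rewrite real_ltNge // ger0_real ?sqrtC_ge0 ?rho_ge0. Qed.

(** Each connected component of the graph spanned by [S] is a proper connected subgraph, still étale
    over [B]; by minimality its radius is below [nu]. The supersolutions of the components glue, as
    a nonbacktracking step inside [S] stays in one component. *)
Lemma min_tangle_subcritical (B psi : graph) (r : nat) (nu : algR) (S : {set gD psi}) :
  algRval nu = sqrtC (rho B) -> 0 < nu -> min_tangle B r psi ->
  (forall e, e \in S -> ginv e \in S) -> S != setT ->
  subcritical (@nonbacktracking psi) S nu.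
Proof.
move=> nuE nu0 [[_ [[f fet] _]] [_ minpsi]] SV ST.
pose a : rel (gV psi) := fun u v => [exists e in S, (gtail e == u) && (ghead e == v)].
have aS e : e \in S -> a (gtail e) (ghead e).
  by move=> eS; apply/exists_inP; exists e => //; rewrite !eqxx.
have asym : symmetric a.
  suff imp u v : a u v -> a v u by move=> u v; apply/idP/idP; apply: imp.
  case/exists_inP=> e eS /andP[/eqP<- /eqP<-].
  by have := aS _ (SV _ eS); rewrite gtailV.
have csym : connect_sym a by exact: sym_connect_sym.
pose U v := [set u | connect a v u]; pose SS v := [set e in S | ghead e \in U v].
have SSV v e : e \in SS v -> ginv e \in SS v.
  rewrite !inE => /andP[eS ve]; rewrite SV //=; apply: connect_trans ve _.
  by rewrite csym connect1 // aS.
have SSU v e : e \in SS v -> ghead e \in U v by rewrite inE => /andP[].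
have sub v : subcritical (@nonbacktracking psi) (SS v) nu.
  pose C := subgraph (SSV v) (SSU v).
  apply/(subcritical_subgraph (SSV v) (SSU v))/rho_lt_subcritical => //.
  rewrite nuE rho_ltNge; apply/negP => rhoC; apply: minpsi.
  exists C, (subgraph_incl (SSV v) (SSU v)); split; last split.
  - split; last first.
      split=> //; exists (comp_morphism f (subgraph_incl (SSV v) (SSU v))).
      exact/comp_etale_embedding/subgraph_incl_embedding.
    have vU : v \in U v by rewrite inE connect0.
    have fromv (u : gV C) : connect (@adj C) (exist _ v vU) u.
      case: u => u uU; have := uU; rewrite [X in is_true X -> _]inE => /connectP[p pth lst].
      elim/last_ind: p u uU pth lst => [|p w IH] u uU /=.
        by move=> _ uv; subst u; rewrite (bool_irrelevance uU vU) connect0.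
      rewrite rcons_path last_rcons => /andP[pth aw] uw; subst u.
      have xU : last v p \in U v by rewrite inE; apply/connectP; exists p.
      apply: connect_trans (IH _ xU pth erefl) (connect1 _).
      case/exists_inP: aw => e eS /andP[/eqP te /eqP he].
      have eSS : e \in SS v by rewrite inE eS he.
      apply/existsP; exists (exist _ e eSS).
      by apply/andP; split; apply/eqP/val_inj.
    split; first by apply/card_gt0P; exists (exist _ v vU).
    move=> u w; apply: connect_trans (fromv w).
    by rewrite (sym_connect_sym (@adj_sym C)).
  - exact: subgraph_incl_embedding.
  (* If the inclusion were onto, every dart would lie in [SS v], hence in [S]. *)
  case=> _ /= [g _ gK]; case/negP: ST; rewrite -subTset; apply/subsetP => e _.
  by rewrite -(gK e); have := valP (g e); rewrite inE => /andP[].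
have [y yP] := fin_all_exists sub.
(* The canonical representative of a component selects one supersolution for all its darts. *)
exists (fun e => y (fingraph.root a (ghead e)) e) => e eS.
have rootS e' : e' \in S -> e' \in SS (fingraph.root a (ghead e')).
  by move=> e'S; rewrite !inE e'S csym connect_root.
have [y0 ys] := yP _ _ (rootS _ eS); split=> //; move: ys; congr (_ < _).
have rootE e' : e' \in S -> nonbacktracking e e' ->
    fingraph.root a (ghead e) = fingraph.root a (ghead e').
  move=> e'S /andP[/eqP-> _]; apply/eqP.
  by rewrite root_connect // connect1 // aS.
apply: eq_big => e' => [|/andP[e'S ne]]; last first.
  by rewrite (rootE e') //; move: e'S; rewrite inE => /andP[].
apply/andP/andP => -[e'S ne]; split=> //; first by move: e'S; rewrite inE => /andP[].
by rewrite (rootE e') // rootS.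
Qed.

(** * Branching vertices and beads *)

Definition outdeg (G : graph) (v : gV G) : nat := #|[set e | gtail e == v]|.

Lemma card_nonbacktracking (G : graph) (e : gD G) :
  #|[set e' | nonbacktracking e e']|.+1 = outdeg (ghead e).
Proof.
rewrite /outdeg [RHS](cardsD1 (ginv e)) inE gtailV eqxx add1n; congr _.+1.
by apply: eq_card => e'; rewrite !inE andbC eq_sym.
Qed.

Lemma etale_outdeg (G H : graph) (f : morphism G H) (v : gV G) :
  etale f -> (outdeg v <= #|gD H|)%N.
Proof.
move=> /(_ v)[inj _]; rewrite /outdeg -(card_in_imset (f := mD f)) ?max_card //.
by move=> e e' ev ev'; apply: inj; [move: ev | move: ev']; rewrite !inE.
Qed.

Lemma tangle_not_subcritical (B psi : graph) (nu : algR) :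
  algRval nu = sqrtC (rho B) -> 0 < nu -> is_tangle B psi ->
  ~ subcritical (@nonbacktracking psi) setT nu.
Proof.
move=> nuE nu0 [_ [_ rhopsi]] /(rho_lt_subcritical _ nu0).
by rewrite nuE rho_ltNge rhopsi.
Qed.

(** By connectedness, a vertex of degree 0 leaves no darts at all. At a vertex of degree 1, removing
    its edge leaves a subcritical set, and the two removed darts are restored by
    [subcritical_extension]. *)
Lemma min_tangle_outdeg_ge2 (B psi : graph) (r : nat) (nu : algR) :
  algRval nu = sqrtC (rho B) -> 1 < nu -> min_tangle B r psi ->
  forall v : gV psi, (1 < outdeg v)%N.
Proof.
move=> nuE nu1 mpsi v; have nu0 : 0 < nu by lra.
have [tpsi _] := mpsi; have [[_ conn] _] := tpsi.
rewrite ltnNge; apply/negP => v1.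
apply: (tangle_not_subcritical nuE nu0 tpsi).
have [/cards0_eq v0|] := eqVneq (outdeg v) 0.
  exists (fun=> 0) => e; have noout e' : gtail e' != v.
    by apply/negP => ve; have := in_set0 e'; rewrite -v0 inE ve.
  case/connectP: (conn v (gtail e)) => -[|w p] /= => [_ ev|/andP[/existsP[e' /andP[/eqP ve _]]]].
    by have := noout e; rewrite ev eqxx.
  by have := noout e'; rewrite ve eqxx.
rewrite -lt0n => v0.
have /eqP/cards1P[e0 e0P] : outdeg v = 1 by apply/eqP; rewrite eqn_leq v1 v0.
have e0v e : (gtail e == v) = (e == e0).
  by have /setP/(_ e) := e0P; rewrite !inE.
have inv0 : ginv e0 != e0 := ginv_nofix e0.
have he0 : ghead e0 != v by rewrite -gtailV e0v.
have [L LP] := @subcritical_extension nu #|gD psi| #|gD psi| nu1.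
pose S : {set gD psi} := [set e | (e != e0) && (e != ginv e0)].
(* [e0] has no predecessor, so the large exponent [L] costs nothing elsewhere; [ginv e0] has no
   successor and takes exponent 0. *)
apply: (LP _ _ S (fun e => if e == e0 then L else 0)); rewrite ?max_card //.
- by move=> x; rewrite max_card.
- apply: (min_tangle_subcritical nuE nu0 mpsi).
    move=> e; rewrite !inE => /andP[n1 n2].
    by rewrite (inj_eq (@ginv_inj psi)) n1 -(inj_eq (@ginv_inj psi)) ginvK n2.
  by apply/eqP => /setP/(_ e0); rewrite !inE eqxx.
- move=> x x'; rewrite !inE => /andP[_ n2] /andP[/eqP hx _].
  case: eqVneq => //= x'0 _; move: n2; case/negP.
  by rewrite -(inj_eq (@ginv_inj psi)) ginvK -e0v gtailV hx e0v x'0.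
- move=> x; rewrite !inE negb_and !negbK => /orP[]/eqP->.
    right; rewrite eqxx; split=> // x' /andP[/eqP hx _]; right.
    by case: eqP => // x'0; move: he0; rewrite hx e0v x'0 eqxx.
  left; have nosucc x' : ~~ nonbacktracking (ginv e0) x'.
    apply/negP => /andP[/eqP h]; rewrite ginvK -e0v -h.
    by have := e0v e0; rewrite /gtail !eqxx => ->.
  split=> [|x']; last by rewrite (negPf (nosucc x')).
  rewrite (_ : [set _ | _] = set0) ?cards0 //.
  by apply/setP => x'; rewrite !inE (negPf (nosucc x')).
Qed.

(** * Walking back to the last branching vertex *)

Lemma nonbacktracking_succ_uniq (G : graph) (p b b' : gD G) :
  (outdeg (ghead p) <= 2)%N -> nonbacktracking p b -> nonbacktracking p b' -> b = b'.
Proof.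
rewrite -card_nonbacktracking ltnS => /card_le1_eqP H pb pb'.
by apply: H; rewrite inE.
Qed.

Lemma nonbacktracking_pred_uniq (G : graph) (p p' b : gD G) :
  (outdeg (gtail b) <= 2)%N -> nonbacktracking p b -> nonbacktracking p' b -> p = p'.
Proof.
rewrite -[nonbacktracking p b]nonbacktrackingV -[nonbacktracking p' b]nonbacktrackingV.
by move=> d2 pb p'b; apply/ginv_inj/(nonbacktracking_succ_uniq d2 pb p'b).
Qed.

(** The predecessor is arbitrary when the tail is branching and unique when it has degree 2; [e] is
    only the default when there is none. *)
Definition prev_dart (G : graph) (e : gD G) : gD G :=
  if [pick p | nonbacktracking p e] is Some p then p else e.

Lemma prev_dartP (G : graph) (e : gD G) :
  (1 < outdeg (gtail e))%N -> nonbacktracking (prev_dart e) e.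
Proof.
rewrite /prev_dart; case: pickP => // none.
rewrite -(card_nonbacktracking (ginv e)) ltnS => /card_gt0P[b].
by rewrite inE -nonbacktrackingV ginvK none.
Qed.

Definition branch (G : graph) (v : gV G) : bool := (2 < outdeg v)%N.

(** [K] consists of the tails of the darts whose backward orbit meets no branching vertex. On these
    darts the predecessor map is injective, hence a permutation, so that [K] is a union of cycles
    cut off from the rest. *)
Lemma unbranched_closed_set (G : graph) (e0 : gD G) :
  (forall v : gV G, 1 < outdeg v)%N ->
  (forall k, ~~ branch (gtail (iter k (@prev_dart G) e0))) ->
  exists K : {set gV G}, [/\ K != set0, {in K, forall v, outdeg v = 2} &
    forall e : gD G, gtail e \in K -> ghead e \in K].
Proof.
move=> deg2 nobr; pose pr := @prev_dart G.
pose Bad := [set e | [forall e', fconnect pr e e' ==> ~~ branch (gtail e')]].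
have Badt e : e \in Bad -> outdeg (gtail e) = 2.
  rewrite inE => /forallP/(_ e); rewrite connect0 /= -leqNgt => le2.
  by apply/eqP; rewrite eqn_leq le2 deg2.
have Bad0 : e0 \in Bad.
  by rewrite inE; apply/forallP => e'; apply/implyP => /iter_findex<-.
have prP e : nonbacktracking (pr e) e by apply: prev_dartP.
have prh e : ghead (pr e) = gtail e by case/andP: (prP e) => /eqP.
have Badpr e : e \in Bad -> pr e \in Bad.
  rewrite !inE => /forallP H; apply/forallP => e'; apply/implyP => ee'.
  by apply: (implyP (H e')); apply: connect_trans ee'; rewrite fconnect1.
have prinj : {in Bad &, injective pr}.
  move=> b b' bB b'B E; apply: (@nonbacktracking_succ_uniq _ (pr b)) => //.
    by rewrite prh Badt.
  by rewrite E.
have Badim : pr @: Bad = Bad.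
  apply/eqP; rewrite eqEcard (card_in_imset prinj) leqnn andbT.
  by apply/subsetP => _ /imsetP[e eB ->]; apply: Badpr.
exists (@gtail G @: Bad); split.
- by apply/set0Pn; exists (gtail e0); rewrite imset_f.
- by move=> _ /imsetP[e eB ->]; apply: Badt.
(* The tail of [b] has degree 2: the darts leaving it are [b] and the inverse of [pr b]. *)
move=> e /imsetP[b bB tb]; have [->|neb] := eqVneq e b.
  have /imsetP[b' b'B ->] : b \in pr @: Bad by rewrite Badim.
  by rewrite prh imset_f.
have -> : e = ginv (pr b).
  rewrite -[e]ginvK; congr ginv.
  apply: (@nonbacktracking_pred_uniq _ _ _ b); rewrite ?Badt //.
  by rewrite /nonbacktracking ginvK -tb eqxx eq_sym.
by rewrite -/(gtail _) imset_f // Badpr.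
Qed.

(** These equations describe the number of backward steps from [e] to the first dart whose tail is
    branching. *)
Definition branch_distance (G : graph) (a : gD G -> nat) : Prop :=
  (forall e, branch (gtail e) -> a e = 0) /\
  (forall e e', nonbacktracking e e' -> ~~ branch (ghead e) -> a e' = (a e).+1).

Lemma branch_distance_exists (G : graph) :
  (forall v : gV G, 1 < outdeg v)%N ->
  (forall e, exists k, branch (gtail (iter k (@prev_dart G) e))) ->
  exists a : gD G -> nat, branch_distance a.
Proof.
move=> deg2 H; exists (fun e => ex_minn (H e)); split=> [e be|e e' ee' nb].
  by case: ex_minnP => m _ /(_ 0 be); rewrite leqn0 => /eqP.
have he : ghead e = gtail e' by case/andP: ee' => /eqP.
have pe : prev_dart e' = e.
  apply: (@nonbacktracking_pred_uniq _ _ _ e') => //; last exact: prev_dartP.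
  by rewrite leqNgt -he.
case: ex_minnP => m mP mmin; case: ex_minnP => n nP nmin.
case: m mP mmin => [|m]; first by rewrite /= -he (negPf nb).
rewrite iterSr pe => mP mmin; apply/eqP; rewrite eqSS eqn_leq nmin // andbT.
by rewrite -ltnS mmin // iterSr pe.
Qed.

Lemma branch_distance_or_closed (G : graph) :
  (forall v : gV G, 1 < outdeg v)%N ->
  (exists a : gD G -> nat, branch_distance a) \/
  exists K : {set gV G}, [/\ K != set0, {in K, forall v, outdeg v = 2} &
    forall e : gD G, gtail e \in K -> ghead e \in K].
Proof.
move=> deg2.
have [H|/not_all_ex_not[e0 H]] :=
  classic (forall e, exists k, branch (gtail (iter k (@prev_dart G) e))).
  by left; apply: branch_distance_exists.
right; apply: (@unbranched_closed_set _ e0) => // k.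
by apply/negP => be; apply: H; exists k.
Qed.

(** * Counting branching darts and beads *)

Lemma outdeg_sum (G : graph) (P : pred (gV G)) :
  (\sum_(v | P v) outdeg v)%N = #|[set e : gD G | P (gtail e)]|.
Proof.
rewrite -sum1_card (partition_big (@gtail G) P) /= => [|e]; last by rewrite inE.
apply: eq_bigr => v Pv; rewrite /outdeg -sum1_card; apply: eq_bigl => e.
by rewrite !inE; case: eqP => [->|]; rewrite ?Pv ?andbF.
Qed.

(** The sum of [outdeg v - 2] is [#|D| - 2 #|V|], which is less than [2 r] even allowing for the
    rounding in [nedges]; and [d <= 3 (d - 2)] for [d >= 3]. *)
Lemma card_branch_darts (G : graph) (r : nat) :
  (forall v : gV G, 1 < outdeg v)%N -> ord G < r%:Z ->
  (#|[set e : gD G | branch (gtail e)]| <= 6 * r)%N.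
Proof.
move=> deg2; rewrite /ord /nedges /nverts => ordG.
have tot : (\sum_(v : gV G) outdeg v)%N = #|gD G|.
  by rewrite outdeg_sum -cardsT; apply: eq_card => e; rewrite !inE.
have exc : (\sum_(v : gV G) (outdeg v - 2) + 2 * #|gV G|)%N = #|gD G|.
  rewrite -tot mulnC -sum_nat_const -big_split /=; apply: eq_bigr => v _.
  by rewrite subnK // ltnW.
have le3 : (\sum_(v : gV G | branch v) outdeg v <= 3 * \sum_(v : gV G) (outdeg v - 2))%N.
  rewrite big_distrr /= [leqRHS](bigID (@branch G)) /= -[leqLHS]addn0 leq_add //.
  by apply: leq_sum => v; rewrite /branch; lia.
move: le3; rewrite outdeg_sum; lia.
Qed.

(** On the bead through [e], [a e] darts come before [e] and [a (ginv e)] after it. *)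
Definition bead_length (G : graph) (a : gD G -> nat) (e : gD G) : nat :=
  (a e + a (ginv e)).+1.

Section BranchDistance.
Variables (G : graph) (a : gD G -> nat).
Hypotheses (deg2 : forall v : gV G, (1 < outdeg v)%N) (aP : branch_distance a).

Lemma branch_distance_prev e : ~~ branch (gtail e) -> a e = (a (prev_dart e)).+1.
Proof.
move=> nbr; have pe := prev_dartP (deg2 (gtail e)).
by apply: (proj2 aP) => //; case/andP: pe => /eqP->.
Qed.

Lemma bead_lengthV e : bead_length a (ginv e) = bead_length a e.
Proof. by rewrite /bead_length ginvK addnC. Qed.

Lemma bead_length_succ e e' : nonbacktracking e e' -> ~~ branch (ghead e) ->
  bead_length a e' = bead_length a e.
Proof.
move=> ee' nbr; rewrite /bead_length (proj2 aP _ _ ee' nbr).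
have -> : a (ginv e) = (a (ginv e')).+1; last by rewrite addSnnS.
apply: (proj2 aP); first by rewrite nonbacktrackingV.
by rewrite -/(gtail e') -(eqP (proj1 (andP ee'))).
Qed.

(** Oriented beads can therefore be counted through their initial darts, those with [a e0 = 0]. *)
Lemma bead_start e : exists e0, a e0 = 0 /\ bead_length a e0 = bead_length a e.
Proof.
have [n] := ubnP (a e); elim: n e => // n IH e; rewrite ltnS => an.
have [be|nbr] := boolP (branch (gtail e)); first by exists e; rewrite (proj1 aP).
have ae := branch_distance_prev nbr.
have [|e0 [a0 le0]] := IH (prev_dart e); first by rewrite -ae.
have pe := prev_dartP (deg2 (gtail e)).
exists e0; split=> //; rewrite le0; apply/esym/bead_length_succ => //.
by case/andP: pe => /eqP->.
Qed.

Lemma branch_distance0 e : (a e == 0) = branch (gtail e).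
Proof.
apply/idP/idP => [|be]; last by rewrite (proj1 aP).
by apply: contraLR => nbr; rewrite branch_distance_prev.
Qed.

(** [prev_dart] maps level [n.+1] of [a] injectively into level [n], because the vertex crossed has
    degree 2; level 0 is the set of branching darts. *)
Lemma card_branch_distance_lt t :
  (#|[set e | a e < t]| <= #|[set e : gD G | branch (gtail e)]| * t)%N.
Proof.
have lev n : (#|[set e | a e == n]| <= #|[set e : gD G | branch (gtail e)]|)%N.
  elim: n => [|n IH].
    by rewrite (eq_card (B := [set e : gD G | branch (gtail e)])) // => e; rewrite !inE branch_distance0.
  apply: leq_trans IH; rewrite -(card_in_imset (f := @prev_dart G)).
    apply/subset_leq_card/subsetP => _ /imsetP[e + ->]; rewrite !inE => /eqP ae.
    by rewrite -eqSS -branch_distance_prev ?ae // -branch_distance0 ae.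
  move=> e e'; rewrite !inE => /eqP ae /eqP ae' E.
  have pe := prev_dartP (deg2 (gtail e)); have pe' := prev_dartP (deg2 (gtail e')).
  apply: (@nonbacktracking_succ_uniq _ (prev_dart e)) => //; last by rewrite E.
  by rewrite (eqP (proj1 (andP pe))) leqNgt -/(branch _) -branch_distance0 ae.
elim: t => [|t IH]; first by rewrite muln0 (_ : [set _ | _] = set0) ?cards0 //; apply/setP => e; rewrite !inE ltn0.
rewrite (_ : [set e | a e < t.+1]%N = [set e | a e < t]%N :|: [set e | a e == t]).
  by apply: leq_trans (leq_card_setU _ _) _; rewrite mulnS addnC leq_add.
by apply/setP => e; rewrite !inE ltnS leq_eqVlt orbC.
Qed.

End BranchDistance.

(** Otherwise the closed set [K] is everything by connectedness, each dart has exactly one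
    successor, and the constant 1 is a supersolution as [nu > 1]. *)
Lemma min_tangle_branch_distance (B psi : graph) (r : nat) (nu : algR) :
  algRval nu = sqrtC (rho B) -> 1 < nu -> min_tangle B r psi ->
  exists a : gD psi -> nat, branch_distance a.
Proof.
move=> nuE nu1 mpsi; have deg2 := min_tangle_outdeg_ge2 nuE nu1 mpsi.
have [//|[K [/set0Pn[v vK] K2 Kcl]]] := branch_distance_or_closed deg2.
have nu0 : 0 < nu by lra.
have [tpsi _] := mpsi; have [[_ conn] _] := tpsi.
have KT w : w \in K.
  case/connectP: (conn v w) => p + ->; elim: p v vK => //= x p IH v vK.
  case/andP=> /existsP[e /andP[/eqP te /eqP he]]; apply: IH.
  by rewrite -he Kcl // te.
case: (tangle_not_subcritical nuE nu0 tpsi).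
exists (fun=> 1) => e _; split=> //.
rewrite (eq_bigl (mem [set e' | nonbacktracking e e'])) => [|e']; last by rewrite !inE.
rewrite sumr_const mulr1.
by have := card_nonbacktracking e; rewrite K2 // => -[->].
Qed.

(* Among the at most 6 r oriented beads of a minimal tangle there can be no large gap in the lengths: otherwise
   removing the long beads leaves a subcritical graph to which subcritical_extension applies. *)
Lemma min_tangle_card_bound (B : graph) (r : nat) (nu : algR) :
  algRval nu = sqrtC (rho B) -> 1 < nu ->
  exists N, forall psi, min_tangle B r psi -> (#|gD psi| <= N)%N.
Proof.
move=> nuE nu1; have nu0 : 0 < nu by lra.
(* The second alternative counts initial darts of short beads; at [i = 6 r + 1] it contradicts
   [card_branch_darts]. *)
have thr i : exists t, forall psi (a : gD psi -> nat), min_tangle B r psi -> branch_distance a ->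
    (forall e, bead_length a e <= t)%N \/
    (i <= #|[set e | (a e == 0) && (bead_length a e <= t)%N]|)%N.
  elim: i => [|i [t IH]]; first by exists 0 => psi a _ _; right.
  have [L LP] := @subcritical_extension nu #|gD B| (6 * r * t) nu1.
  (* A bead with length in the window above [t] raises the count by at least one; an empty window is
     the gap to be excluded. *)
  exists (maxn t L).+1 => psi a mpsi aP.
  have deg2 := min_tangle_outdeg_ge2 nuE nu1 mpsi.
  have [H|cnt] := IH psi a mpsi aP; first by left=> e; have := H e; lia.
  have [H|] := boolP [forall e, bead_length a e <= (maxn t L).+1]%N.
    by left=> e; apply: (forallP H).
  rewrite negb_forall => /existsP[e1]; rewrite -ltnNge => e1big; right.
  have [|none] := boolP [exists e, t < bead_length a e <= (maxn t L).+1]%N.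
    case/existsP=> e /andP[te eL]; have [e0 [a0 l0]] := bead_start deg2 aP e.
    apply: leq_ltn_trans cnt _; apply/proper_card/properP; split.
      by apply/subsetP => x; rewrite !inE => /andP[-> /=]; lia.
    by exists e0; rewrite !inE a0 l0 eqxx /= -?ltnNge.
  have gap e : ((bead_length a e <= t) || (maxn t L < (bead_length a e).-1))%N.
    by move: none; rewrite negb_exists => /forallP/(_ e); lia.
  pose S : {set gD psi} := [set e | bead_length a e <= t]%N.
  have [tpsi [ordpsi _]] := mpsi; have [_ [[f fet] _]] := tpsi.
  case: (tangle_not_subcritical nuE nu0 tpsi).
  apply: (LP _ _ S a).
  - move=> e; apply: leq_trans (etale_outdeg (ghead e) fet).
    by rewrite -card_nonbacktracking.
  - apply: leq_trans (_ : #|[set e | a e < t]| <= _)%N.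
      by apply/subset_leq_card/subsetP => e; rewrite !inE /bead_length; lia.
    apply: leq_trans (card_branch_distance_lt deg2 aP t) _.
    by rewrite leq_mul2r card_branch_darts // orbT.
  - apply: (min_tangle_subcritical nuE nu0 mpsi) => [e|].
      by rewrite !inE bead_lengthV.
    by apply/eqP => /setP/(_ e1); rewrite !inE; lia.
  - move=> e e'; rewrite !inE => eS ee' e'S; apply/eqP.
    rewrite (branch_distance0 deg2 aP) -(eqP (proj1 (andP ee'))).
    by apply: contraR e'S => nbr; rewrite (bead_length_succ aP ee' nbr).
  move=> e; rewrite !inE => eS; have [be|nbr] := boolP (branch (ghead e)).
    right; split.
      (* At the last dart of a long bead, [a e] is the length minus 1, which exceeds [L] by
         [gap]. *)
      have : a (ginv e) = 0 by apply: (proj1 aP); rewrite gtailV.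
      by move: (gap e) eS; rewrite /bead_length => /[swap] /negPf-> /=; lia.
    move=> e' ee'; right; apply/eqP.
    by rewrite (branch_distance0 deg2 aP) -(eqP (proj1 (andP ee'))).
  left; split.
    by rewrite -ltnS card_nonbacktracking leqNgt.
  move=> e' ee'; rewrite inE (bead_length_succ aP ee' nbr) (proj2 aP _ _ ee' nbr).
  by split.
have [t tP] := thr (6 * r).+1; exists (6 * r * t)%N => psi mpsi.
have [a aP] := min_tangle_branch_distance nuE nu1 mpsi.
have deg2 := min_tangle_outdeg_ge2 nuE nu1 mpsi.
have [_ [ordpsi _]] := mpsi.
have [H|] := tP psi a mpsi aP.
  apply: leq_trans (_ : #|[set e | a e < t]| <= _)%N.
    by apply/subset_leq_card/subsetP => e _; rewrite !inE; have := H e; rewrite /bead_length; lia.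
  apply: leq_trans (card_branch_distance_lt deg2 aP t) _.
  by rewrite leq_mul2r card_branch_darts // orbT.
rewrite ltnNge => /negP[]; apply: leq_trans (card_branch_darts deg2 ordpsi).
apply/subset_leq_card/subsetP => e; rewrite !inE => /andP[+ _].
by rewrite (branch_distance0 deg2 aP).
Qed.

(** * The spectral radius of a graph of negative Euler characteristic *)

Lemma induced_subgraph_stable (G : graph) (U : {set gV G}) (e : gD G) :
  e \in [set e | (gtail e \in U) && (ghead e \in U)] ->
  ginv e \in [set e | (gtail e \in U) && (ghead e \in U)].
Proof. by rewrite !inE gtailV andbC. Qed.

Lemma induced_subgraph_head (G : graph) (U : {set gV G}) (e : gD G) :
  e \in [set e | (gtail e \in U) && (ghead e \in U)] -> ghead e \in U.
Proof. by rewrite inE => /andP[]. Qed.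

Definition induced_subgraph (G : graph) (U : {set gV G}) : graph :=
  subgraph (@induced_subgraph_stable G U) (@induced_subgraph_head G U).

Lemma subcriticalS (T : finType) (e : rel T) (S S' : {set T}) c :
  S \subset S' -> subcritical e S' c -> subcritical e S c.
Proof.
move=> SS [y yP]; exists y => x xS; have [y0 ys] := yP x (subsetP SS x xS).
split=> //; apply: le_lt_trans ys; rewrite [leRHS]big_mkcond [leLHS]big_mkcond.
apply: ler_sum => z _; have [zS|zS] := boolP (z \in S).
  by rewrite (subsetP SS _ zS) lexx.
by rewrite /=; case: ifP => // /andP[/yP[/ltW]].
Qed.

(* Weighting a dart by c ^ (- distance to the last branching) gives a left subsolution, which is
   incompatible with a right supersolution. *)
Lemma branch_distance_not_subcritical (G : graph) (a : gD G -> nat) :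
  (forall v : gV G, 1 < outdeg v)%N -> branch_distance a -> (0 < #|gD G|)%N ->
  exists2 c : algR, 1 < c & ~ subcritical (@nonbacktracking G) setT c.
Proof.
move=> deg2 aP /card_gt0P[d _]; pose N := \max_e a e.
have aN e : (a e <= N)%N by apply: leq_bigmax.
(* The first dart of a bead has weight [c ^ N], and [c * c ^ N = 2] is covered by two predecessors
   of weight at least 1 each. *)
have [c c1 cN] : exists2 c : algR, 1 < c & c ^+ N.+1 = 2%:R.
  have rt : N.+1.-root (2%:R : algC) \is Num.real by rewrite ger0_real // rootC_ge0 // ler0n.
  exists (in_algR rt); last by apply: val_inj; rewrite rmorphXn /= rootCK // rmorph_nat.
  by rewrite -algRval_lt rmorph1 /= rootC_gt1 // ltr1n.
have c0 : 0 < c by lra.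
exists c => // -[y yP].
have y0 e : 0 < y e by case: (yP e (in_setT _)).
pose z e := c ^+ (N - a e).
have z0 e : 0 < z e by rewrite exprn_gt0.
have z1 e : 1 <= z e by rewrite exprn_ege1 // ltW.
have pred_ge e' : c * z e' <= \sum_(e | nonbacktracking e e') z e.
  have pe := prev_dartP (deg2 (gtail e')).
  rewrite (bigD1 (prev_dart e')) //=.
  have rest : 0 <= \sum_(e | nonbacktracking e e' && (e != prev_dart e')) z e.
    by rewrite sumr_ge0 // => e _; apply: ltW.
  have [be|nbr] := boolP (branch (gtail e')); last first.
    have ae := branch_distance_prev deg2 aP nbr.
    have -> : c * z e' = z (prev_dart e').
      by rewrite /z -exprS; congr (_ ^+ _); have := aN e'; rewrite ae; lia.
    by rewrite lerDl.
  have : [exists p, nonbacktracking p e' && (p != prev_dart e')].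
    apply: contraLR be; rewrite negb_exists -leqNgt => /forallP none.
    rewrite -[gtail e']/(ghead (ginv e')) -card_nonbacktracking ltnS.
    apply/card_le1_eqP => p p'; rewrite !inE => pe1 pe2.
    suff H q : nonbacktracking (ginv e') q -> q = ginv (prev_dart e') by rewrite (H _ pe1) (H _ pe2).
    rewrite -nonbacktrackingV ginvK => /[dup] qe.
    by have := none (ginv q); rewrite qe /= negbK => /eqP<-; rewrite ginvK.
  case/existsP=> p /andP[pe' pne]; rewrite (bigD1 p) /=; last by rewrite pe'.
  have rest' : 0 <= \sum_(e | nonbacktracking e e' && (e != prev_dart e') && (e != p)) z e.
    by rewrite sumr_ge0 // => e _; apply: ltW.
  have -> : c * z e' = 2%:R by rewrite /z (proj1 aP) // subn0 -exprS.
  by have := z1 p; have := z1 (prev_dart e'); lra.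
(* The pairing of [z] with the image of [y] is estimated twice: strictly from above by [yP], from
   below by [pred_ge]. *)
have : \sum_e z e * (\sum_(e' | nonbacktracking e e') y e') < \sum_e z e * (c * y e).
  have lt e : z e * (\sum_(e' | nonbacktracking e e') y e') < z e * (c * y e).
    rewrite ltr_pM2l //; have [_] := yP e (in_setT _).
    by under eq_bigl do rewrite inE.
  rewrite (bigD1 d) //= [ltRHS](bigD1 d) //= ltr_leD // ler_sum // => e _.
  exact: ltW.
rewrite ltNge => /negP[].
under [leRHS]eq_bigr do rewrite mulr_sumr.
rewrite (exchange_big_dep predT) //=; apply: ler_sum => e' _.
by rewrite -mulr_suml mulrCA mulrA ler_pM2r.
Qed.

(** Induction on the number of vertices: deleting a vertex of degree at most 1, or a closed set of
    vertices of degree 2, removes at most two darts per vertex and so preserves the inequality. When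
    neither exists, a branch distance does. *)
Lemma not_subcritical_gt1 (G : graph) : (2 * #|gV G| < #|gD G|)%N ->
  exists2 c : algR, 1 < c & ~ subcritical (@nonbacktracking G) setT c.
Proof.
have [n] := ubnP #|gV G|; elim: n G => // n IH G; rewrite ltnS => Vn DV.
have reduce (U : {set gV G}) : (#|U| < #|gV G|)%N ->
    (2 * #|U| < #|[set e : gD G | (gtail e \in U) && (ghead e \in U)]|)%N ->
    exists2 c : algR, 1 < c & ~ subcritical (@nonbacktracking G) setT c.
  move=> UV UD; have [||c c1 nc] := IH (induced_subgraph U).
  - by rewrite card_sig; apply: leq_trans Vn.
  - by rewrite !card_sig.
  exists c => // sc; apply: nc.
  by apply/subcritical_subgraph/(subcriticalS _ sc)/subsetT.
have {}reduce (K : {set gV G}) : K != set0 ->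
    (#|[set e : gD G | (gtail e \in K) || (ghead e \in K)]| <= 2 * #|K|)%N ->
    exists2 c : algR, 1 < c & ~ subcritical (@nonbacktracking G) setT c.
  rewrite -card_gt0 => K0 KD; have KC := cardsC K; apply: (reduce (~: K)); first lia.
  have := cardsC [set e : gD G | (gtail e \in K) || (ghead e \in K)].
  rewrite (_ : ~: [set e : gD G | _] = [set e | (gtail e \in ~: K) && (ghead e \in ~: K)]).
    lia.
  by apply/setP => e; rewrite !inE negb_or.
have [deg2|] := boolP [forall v : gV G, 1 < outdeg v]%N; last first.
  rewrite negb_forall => /existsP[v]; rewrite -leqNgt => v1.
  apply: (reduce [set v]); first by apply/set0Pn; exists v; rewrite inE.
  rewrite cards1; apply: leq_trans (_ : (#|[set e | gtail e == v] :|: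
     @ginv G @: [set e | gtail e == v]| <= _)%N).
    apply/subset_leq_card/subsetP => e; rewrite !inE => /orP[->//|he].
    by apply/orP; right; apply/imsetP; exists (ginv e); rewrite ?inE ?gtailV ?ginvK.
  apply: leq_trans (leq_card_setU _ _) _.
  rewrite (card_imset _ (@ginv_inj G)); rewrite /outdeg in v1; lia.
move/forallP: deg2 => deg2.
have [[a aP]|[K [K0 K2 Kcl]]] := branch_distance_or_closed deg2.
  by apply: (branch_distance_not_subcritical deg2 aP); lia.
apply: (reduce K K0); rewrite mulnC -sum_nat_const.
rewrite -(eq_bigr _ K2) (outdeg_sum (mem K)).
apply/subset_leq_card/subsetP => e; rewrite !inE => /orP[//|he].
by have := Kcl (ginv e); rewrite gtailV => /(_ he).
Qed.

Lemma rho_gt1 (B : graph) : euler_char B < 0 -> 1 < rho B.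
Proof.
rewrite /euler_char /nverts /nedges => chi.
have [|c c1 nc] := @not_subcritical_gt1 B; first lia.
have c0 : 0 < c by lra.
have c1' : 1 < algRval c by [].
apply: lt_le_trans c1' _.
rewrite real_leNgt ?(algRvalP c) ?ger0_real ?rho_ge0 //.
by apply/negP => /(rho_lt_subcritical _ c0).
Qed.

(** * Minimal tangles *)

(** While [A] is not everything, an edge leaves it; adjoining this edge and its new endpoint adds
    two darts and one vertex, which keeps [#|S| - 2 #|A|] constant. *)
Lemma connected_card_le (G : graph) (A : {set gV G}) (S : {set gD G}) :
  connected G -> A != set0 -> (forall e, e \in S -> ghead e \in A /\ gtail e \in A) ->
  (#|S| + 2 * #|gV G| <= #|gD G| + 2 * #|A|)%N.
Proof.
move=> [_ conn]; have [n] := ubnP #|~: A|; elim: n A S => // n IH A S.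
rewrite ltnS => An A0 SA.
have [AT|] := boolP [forall e, (gtail e \in A) ==> (ghead e \in A)].
  have [u uA] := set0Pn _ A0.
  have -> : A = setT.
    apply/setP => w; rewrite inE; case/connectP: (conn u w) => p + ->.
    elim: p u uA => //= x p IHp u uA /andP[/existsP[e /andP[/eqP te /eqP he]]].
    by apply: IHp; rewrite -he (implyP (forallP AT e)) // te.
  by rewrite cardsT leq_add2r max_card.
rewrite negb_forall => /existsP[e]; rewrite negb_imply => /andP[te he].
have eS : e \notin S by apply: contra he => /SA[].
have eVS : ginv e \notin S by apply: contra he => /SA[_]; rewrite gtailV.
have AC : (#|~: (ghead e |: A)| < n)%N.
  apply: leq_trans An; apply/proper_card/properP; split.
    by apply/subsetP => x; rewrite !inE negb_or => /andP[].
  by exists (ghead e); rewrite !inE ?eqxx.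
have nz : ghead e |: A != set0 by apply/set0Pn; exists (ghead e); rewrite !inE eqxx.
have cl x : x \in e |: (ginv e |: S) -> ghead x \in ghead e |: A /\ gtail x \in ghead e |: A.
  rewrite !inE => /or3P[/eqP->|/eqP->|/SA[-> ->]]; rewrite ?orbT //.
    by rewrite eqxx te orbT.
  by rewrite gtailV -/(gtail e) te eqxx orbT.
have := IH _ _ AC nz cl.
rewrite !cardsU1 he !inE negb_or [e == _]eq_sym (negPf (ginv_nofix e)) eS eVS /=.
lia.
Qed.

Lemma embedding_ord_le (phi psi : graph) (f : morphism phi psi) :
  connected phi -> connected psi -> embedding f -> ord phi <= ord psi.
Proof.
move=> [/card_gt0P[v _] _] conn [fV fD]; rewrite /ord /nedges /nverts.
have := @connected_card_le psi (mV f @: setT) (mD f @: setT) conn.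
rewrite !card_imset // !cardsT => H.
have {}H : (#|gD phi| + 2 * #|gV psi| <= #|gD psi| + 2 * #|gV phi|)%N.
  apply: H; first by apply/set0Pn; exists (mV f v); rewrite imset_f.
  by move=> _ /imsetP[e _ ->]; rewrite mD_head mD_tail !imset_f.
lia.
Qed.

Lemma id_embedding (G : graph) : exists f : morphism G G, embedding f.
Proof. by unshelve eexists; [exists id id|split]. Qed.

Lemma embedding_card_lt (phi psi : graph) (f : morphism phi psi) :
  embedding f -> ~ isomorphism f ->
  (#|gV phi| + #|gD phi| < #|gV psi| + #|gD psi|)%N.
Proof.
move=> [fV fD] niso; have leV := leq_card _ fV; have leD := leq_card _ fD.
rewrite ltnNge; apply/negP => ge; apply: niso.
by split; apply: inj_card_bij => //; lia.
Qed.

Lemma tangle_contains_min_tangle (B : graph) (r : nat) (psi : graph) :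
  is_tangle B psi -> ord psi < r%:Z ->
  exists (phi : graph) (f : morphism phi psi), min_tangle B r phi /\ embedding f.
Proof.
have [n] := ubnP (#|gV psi| + #|gD psi|)%N; elim: n psi => // n IH psi.
rewrite ltnS => szn tpsi ordpsi.
have [[phi [f [tphi [femb niso]]]]|nsub] := classic (has_proper_subtangle B psi).
  have [||chi [g [mchi gemb]]] := IH phi _ tphi.
  - exact: leq_trans (embedding_card_lt femb niso) szn.
  - exact: le_lt_trans (embedding_ord_le (proj1 tphi) (proj1 tpsi) femb) ordpsi.
  by exists chi, (comp_morphism f g); split=> //; apply: comp_embedding.
have [f femb] := id_embedding psi.
by exists psi, f.
Qed.

(** * Enumeration of the graphs of bounded size *)

Definition graph_code (n m : nat) : finType :=
  {c : {ffun 'I_m -> 'I_m} * {ffun 'I_m -> 'I_n} |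
    [forall e, c.1 (c.1 e) == e] && [forall e, c.1 e != e]}.

Lemma graph_code_invK (n m : nat) (c : graph_code n m) : involutive (val c).1.
Proof. by have /andP[/forallP cK _] := valP c; move=> e; apply/eqP. Qed.

Lemma graph_code_nofix (n m : nat) (c : graph_code n m) e : (val c).1 e != e.
Proof. by have /andP[_ /forallP] := valP c. Qed.

Definition decode (n m : nat) (c : graph_code n m) : graph :=
  @Graph 'I_n 'I_m (val c).1 (val c).2 (graph_code_invK c) (graph_code_nofix c).

Lemma decode_surj (psi : graph) : exists c, isomorphic (@decode #|gV psi| #|gD psi| c) psi.
Proof.
pose inv := [ffun i : 'I_#|gD psi| => enum_rank (ginv (enum_val i))].
pose hd := [ffun i : 'I_#|gD psi| => enum_rank (ghead (enum_val i))].
have cP : [forall e, (inv, hd).1 ((inv, hd).1 e) == e] && [forall e, (inv, hd).1 e != e].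
  apply/andP; split; apply/forallP => e /=; rewrite !ffunE.
    by rewrite enum_rankK ginvK enum_valK.
  by rewrite -(inj_eq enum_val_inj) enum_rankK ginv_nofix.
exists (exist _ (inv, hd) cP).
unshelve eexists.
  exists enum_val enum_val => e /=; by rewrite ffunE enum_rankK.
split; exists enum_rank; by [exact: enum_valK | exact: enum_rankK].
Qed.

Lemma finitely_many_graphs (N : nat) : exists (n : nat) (L : 'I_n -> graph),
  forall psi : graph, (#|gV psi| <= N)%N -> (#|gD psi| <= N)%N ->
    exists i, isomorphic (L i) psi.
Proof.
pose T : finType := {p : 'I_N.+1 * 'I_N.+1 & graph_code p.1 p.2}.
exists #|T|, (fun i => decode (tagged (enum_val i : T))) => psi VN DN.
have [c cpsi] := decode_surj psi.
pose p : 'I_N.+1 * 'I_N.+1 := (Ordinal (VN : #|gV psi| < N.+1)%N, Ordinal (DN : #|gD psi| < N.+1)%N).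
pose x : T := Tagged (fun p : 'I_N.+1 * 'I_N.+1 => graph_code p.1 p.2) (c : graph_code p.1 p.2).
by exists (enum_rank x); rewrite enum_rankK.
Qed.

Lemma outdeg_ge2_card (G : graph) :
  (forall v : gV G, 1 < outdeg v)%N -> (#|gV G| <= #|gD G|)%N.
Proof.
move=> deg2; rewrite -[#|gD G|]cardsT -(_ : [set e : gD G | predT (gtail e)] = setT).
  by rewrite -outdeg_sum -sum1_card; apply: leq_sum => v _; apply: ltnW.
by apply/setP => e; rewrite !inE.
Qed.

Theorem theorem2p46 (B : graph) (r : nat) :
  connected B -> euler_char B < 0 -> (0 < r)%N ->
  (exists (n : nat) (L : 'I_n -> graph),
     forall psi : graph, min_tangle B r psi ->
       exists i : 'I_n, isomorphic (L i) psi) /\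
  (forall psi : graph, is_tangle B psi -> ord psi < r%:Z ->
     exists (phi : graph) (f : morphism phi psi), min_tangle B r phi /\ embedding f).
Proof.
move=> _ chiB _; split; last by move=> psi; apply: tangle_contains_min_tangle.
have nuR : sqrtC (rho B) \is Num.real by rewrite ger0_real // sqrtC_ge0 rho_ge0.
(* The square root is moved to [algR], where the supersolutions live. *)
pose nu := in_algR nuR; have nuE : algRval nu = sqrtC (rho B) by [].
have nu1 : 1 < nu by rewrite -algRval_lt rmorph1 /= rootC_gt1 // rho_gt1.
have [N NP] := min_tangle_card_bound r nuE nu1.
have [n [L LP]] := finitely_many_graphs N.
exists n, L => psi mpsi; apply: LP; last exact: NP.
(* Degrees at least 2 bound the vertices by the darts, so one [N] serves for both. *)
exact: leq_trans (outdeg_ge2_card (min_tangle_outdeg_ge2 nuE nu1 mpsi)) (NP _ mpsi).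
Qed.
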